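(* Let $X\sim \mathrm{mPH}(\boldsymbol{\pi},\mathcal{T})$ with $\mathcal{T}=\{\boldsymbol{T}_1,\dots,\boldsymbol{T}_d\}$. Then for $k,l\in\{1,\dots,d\}$ with $k\neq l$, the Kendall correlation of $X_k$ and $X_l$ is $$\tau_{X_k,X_l}=4\sum_{i=1}^p\sum_{j=1}^p\pi_i\pi_j\,(\boldsymbol{e}_i^{\mathsf{T}}\otimes\boldsymbol{e}_j^{\mathsf{T}})\left[-(\boldsymbol{T}_k\oplus\boldsymbol{T}_k)\right]^{-1}(\boldsymbol{e}\otimes\boldsymbol{t}_k)\;(\boldsymbol{e}_i^{\mathsf{T}}\otimes\boldsymbol{e}_j^{\mathsf{T}})\left[-(\boldsymbol{T}_l\oplus\boldsymbol{T}_l)\right]^{-1}(\boldsymbol{e}\otimes\boldsymbol{t}_l)-1.$$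
   Context: Notation: $\otimes$ and $\oplus$ denote the Kronecker product and Kronecker sum of matrices ($A\oplus B=A\otimes I+I\otimes B$); $\boldsymbol{e}_j$ is the $j$-th canonical basis (column) vector of $\mathbb{R}^p$ and $\boldsymbol{e}=\sum_{j=1}^p\boldsymbol{e}_j$. Kendall correlation: for a random vector $(X_1,X_2)$ and an independent copy $(Z_1,Z_2)$ of it, $\tau_{X_1,X_2}=\mathbb{P}((X_1-Z_1)(X_2-Z_2)>0)-\mathbb{P}((X_1-Z_1)(X_2-Z_2)<0)$. mPH class. Let $\boldsymbol{\pi}=(\pi_1,\dots,\pi_p)$ be a probability row vector and let $\boldsymbol{T}_1,\dots,\boldsymbol{T}_d$ be real $p\times p$ sub-intensity matrices (nonnegative off-diagonal entries, strictly negative diagonal entries, nonpositive row sums) for which all states $1,\dots,p$ are transient (equivalently, each $\boldsymbol{T}_i$ is invertible). Let $\boldsymbol{t}_i=-\boldsymbol{T}_i\boldsymbol{e}$. For $i=1,\dots,d$ let $(J^{(i)}_t)_{t\ge 0}$ be a time-homogeneous Markov jump process on $\{1,\dots,p,p+1\}$ with $p+1$ absorbing, with transition intensities between the states $1,\dots,p$ given by $\boldsymbol{T}_i$ and intensities of jumping to $p+1$ given by $\boldsymbol{t}_i$. Assume that all the processes start in the same state, $J_0^{(1)}=\dots=J_0^{(d)}=:J_0$ with $\mathbb{P}(J_0=j)=\pi_j$ for $j=1,\dots,p$, and that the $d$ processes are conditionally independent given $J_0$. Put $X_i=\inf\{t>0: J^{(i)}_t=p+1\}$. Then $X=(X_1,\dots,X_d)$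 is said to be mPH (multivariate phase-type) distributed, written $X\sim \mathrm{mPH}(\boldsymbol{\pi},\mathcal{T})$ with $\mathcal{T}=\{\boldsymbol{T}_1,\dots,\boldsymbol{T}_d\}$ (indexed by $i=1,\dots,d$). *)

(* Defs.v *)
From HB Require Import structures.
From mathcomp Require Import all_boot all_order all_algebra.
From mathcomp Require Import mxtens.
From mathcomp Require Import all_classical all_reals all_analysis.

Set Implicit Arguments.
Unset Strict Implicit.
Unset Printing Implicit Defensive.

Import Order.TTheory GRing.Theory Num.Theory.
Import numFieldNormedType.Exports.

Local Open Scope classical_set_scope.
Local Open Scope ring_scope.

Section Matrices.
Context {R : realType} {p : nat}.

(* [A *t B] is the Kronecker product of mathcomp.real_closed.mxtens. *)
Definition kron_sum (A B : 'M[R]_p) : 'M[R]_(p * p) :=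
  A *t 1%:M + 1%:M *t B.

Definition basis_vec (j : 'I_p) : 'cV[R]_p := delta_mx j ord0.

Definition ones : 'cV[R]_p := \sum_(j < p) basis_vec j.

Definition exit_rates (T : 'M[R]_p) : 'cV[R]_p := - T *m ones.

Definition sub_intensity (T : 'M[R]_p) : Prop :=
  [/\ forall i j, i != j -> 0 <= T i j,
      forall i, T i i < 0
    & forall i, \sum_(j < p) T i j <= 0].

(* Intensity matrix of the process with the additional absorbing state p+1. *)
Definition full_intensity (T : 'M[R]_p) : 'M[R]_(p + 1) :=
  block_mx T (exit_rates T) 0 0.

Definition probability_vector (v : 'rV[R]_p) : Prop :=
  (forall j, 0 <= v ord0 j) /\ \sum_(j < p) v ord0 j = 1.

End Matrices.

Definition transient_state {p : nat} (j : 'I_p) : 'I_(p + 1) := lshift 1 j.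

Definition absorbing_state {p : nat} : 'I_(p + 1) := rshift p ord0.

(* Transition function with infinitesimal description
   Pt h i j = (i == j) + Q i j * h + o(h) as h decreases to 0. *)
Record transition_function {R : realType} {n : nat}
    (Q : 'M[R]_n) (Pt : R -> 'M[R]_n) : Prop := {
  tf_ge0 : forall t i j, 0 <= t -> 0 <= Pt t i j ;
  tf_sum1 : forall t i, 0 <= t -> \sum_(j < n) Pt t i j = 1 ;
  tf_zero : Pt 0 = 1%:M ;
  tf_chapman_kolmogorov : forall s t, 0 <= s -> 0 <= t ->
    Pt (s + t) = Pt s *m Pt t ;
  tf_intensity : forall i j,
    (Pt h i j - (i == j)%:R) / h @[h --> 0^'+] --> Q i j
}.

Section Processes.
Context {d : measure_display} {Om : measurableType d} {R : realType}.
Variable P : probability Om R.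

(* Processes are indexed by the times t >= 0; values at t < 0 are irrelevant. *)

Definition history {n : nat} (J : R -> Om -> 'I_n) (t : R) : set (set Om) :=
  <<s [set A | exists u s, [/\ 0 <= u, u <= t & A = [set w | J u w = s]] ]>>.

Definition process_events {n : nat} (J : R -> Om -> 'I_n) : set (set Om) :=
  <<s [set A | exists u s, 0 <= u /\ A = [set w | J u w = s] ]>>.

(* The paths are right-continuous with left limits for the discrete topology,
   that is, piecewise constant with finitely many jumps on bounded intervals. *)
Record markov_jump_process {n : nat} (Q : 'M[R]_n) (J : R -> Om -> 'I_n) :
    Prop := {
  mjp_measurable : forall t s, 0 <= t -> measurable [set w | J t w = s] ;
  mjp_right_cont : forall w t, 0 <= t -> \forall s \near t^'+, J s w = J t w ;
  mjp_left_lim : forall w t, 0 < t ->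
    exists s, \forall u \near t^'-, J u w = s ;
  mjp_markov : exists2 Pt, transition_function Q Pt &
    forall t h i j A, 0 <= t -> 0 <= h -> history J t A ->
      P (A `&` [set w | J t w = i /\ J (t + h) w = j]) =
      (P (A `&` [set w | J t w = i]) * (Pt h i j)%:E)%E
}.

Definition cond_prob (A B : set Om) : R := fine (P (A `&` B)) / fine (P B).

Definition cond_independent {n p m : nat}
    (J : 'I_n -> R -> Om -> 'I_m) (J0 : Om -> 'I_p) : Prop :=
  forall (j : 'I_p) (A : 'I_n -> set Om),
    (0 < P [set w | J0 w = j])%E ->
    (forall i, process_events (J i) (A i)) ->
    cond_prob (\bigcap_i A i) [set w | J0 w = j] =
    \prod_(i < n) cond_prob (A i) [set w | J0 w = j].

(* Invertibility of T i expresses that the states 1, ..., p are transient.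
   The infimum is taken in the extended reals; it is almost surely finite. *)
Definition mPH {n p : nat} (v : 'rV[R]_p) (T : 'I_n -> 'M[R]_p)
    (X : 'I_n -> {RV P >-> R}) : Prop :=
  [/\ probability_vector v,
      forall i, sub_intensity (T i) /\ T i \in unitmx
    & exists (J : 'I_n -> R -> Om -> 'I_(p + 1)) (J0 : Om -> 'I_p),
      [/\ forall j, measurable [set w | J0 w = j] /\
            P [set w | J0 w = j] = (v ord0 j)%:E,
          forall i w, J i 0 w = transient_state (J0 w),
          forall i, markov_jump_process (full_intensity (T i)) (J i),
          cond_independent J J0
        & forall i, {ae P, forall w, (X i w)%:E =
            ereal_inf [set t%:E | t in
              [set t : R | 0 < t /\ J i t w = absorbing_state]]}]].

(* The independent copy is realised on the product space: under [P \x P], the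
   vector (X1, X2) of the second coordinate is an independent copy of the
   vector (X1, X2) of the first one; see [kendall_tau_indep_copy]. *)
Definition kendall_tau (X1 X2 : {RV P >-> R}) : R :=
  fine ((P \x P)%E [set w : Om * Om |
          0 < (X1 w.1 - X1 w.2) * (X2 w.1 - X2 w.2)])
  - fine ((P \x P)%E [set w : Om * Om |
          (X1 w.1 - X1 w.2) * (X2 w.1 - X2 w.2) < 0]).

Lemma kendall_tau_indep_copy (X1 X2 Z1 Z2 : {RV P >-> R}) :
  (forall A : set (R * R), measurable A ->
    P [set w | A (Z1 w, Z2 w)] = P [set w | A (X1 w, X2 w)]) ->
  (forall A B : set (R * R), measurable A -> measurable B ->
    P ([set w | A (X1 w, X2 w)] `&` [set w | B (Z1 w, Z2 w)]) =
    (P [set w | A (X1 w, X2 w)] * P [set w | B (Z1 w, Z2 w)])%E) ->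
  kendall_tau X1 X2 =
    fine (P [set w | 0 < (X1 w - Z1 w) * (X2 w - Z2 w)])
    - fine (P [set w | (X1 w - Z1 w) * (X2 w - Z2 w) < 0]).
Proof.
move=> eq_law indep.
have mF : measurable_fun setT (fun w => (X1 w, X2 w) : R * R).
  by apply/measurable_fun_pairP; split; exact: measurable_funP.
have mG : measurable_fun setT (fun w => (Z1 w, Z2 w) : R * R).
  by apply/measurable_fun_pairP; split; exact: measurable_funP.
pose F := mfun_Sub (mem_set mF).
have mFF : measurable_fun setT
    (fun w : Om * Om => ((X1 w.1, X2 w.1), (X1 w.2, X2 w.2))).
  apply/measurable_fun_pairP; split.
    exact: (measurableT_comp mF measurable_fst).
  exact: (measurableT_comp mF measurable_snd).
have mFG : measurable_fun setT
    (fun w : Om => ((X1 w, X2 w), (Z1 w, Z2 w))).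
  by apply/measurable_fun_pairP; split.
pose FF := mfun_Sub (mem_set mFF).
pose FG := mfun_Sub (mem_set mFG).
have key (C : set ((R * R) * (R * R))) : measurable C ->
    (P \x P)%E (FF @^-1` C) = P (FG @^-1` C).
  move=> mC.
  transitivity ((distribution P F \x distribution P F)%E C).
    symmetry.
    apply: (@product_measure_unique _ _ _ _ _ (distribution P F)
      (distribution P F) (measure_function_pushforward__canonical__measure_function_Measure
        (P \x P)%E mFF)) => // A B mA mB.
    rewrite /= /pushforward.
    rewrite -[LHS]/((P \x P)%E ((F @^-1` A) `*` (F @^-1` B))).
    rewrite product_measure1E //.
      by rewrite -[X in measurable X]setTI; exact: (mF measurableT _ mA).
    by rewrite -[X in measurable X]setTI; exact: (mF measurableT _ mB).
  apply: (@product_measure_unique _ _ _ _ _ (distribution P F)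
    (distribution P F) (distribution P FG)) => // A B mA mB.
  transitivity (P ([set w | A (X1 w, X2 w)] `&` [set w | B (Z1 w, Z2 w)])).
    by [].
  by rewrite indep // eq_law.
pose f (z : (R * R) * (R * R)) : R :=
  (z.1.1 - z.2.1) * (z.1.2 - z.2.2).
have mf : measurable_fun setT f.
  apply: measurable_realfun.measurable_funM;
    apply: measurable_realfun.measurable_funB.
  - exact: (measurableT_comp measurable_fst measurable_fst).
  - exact: (measurableT_comp measurable_fst measurable_snd).
  - exact: (measurableT_comp measurable_snd measurable_fst).
  - exact: (measurableT_comp measurable_snd measurable_snd).
have mpos : measurable [set z | 0 < f z].
  rewrite (_ : [set z | 0 < f z] = setT `&` f @^-1` `]0, +oo[).
    exact: mf.
  by rewrite set_itvoy setTI.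
have mneg : measurable [set z | f z < 0].
  rewrite (_ : [set z | f z < 0] = setT `&` f @^-1` `]-oo, 0[).
    exact: mf.
  by rewrite set_itvNyo setTI.
by congr (fine _ - fine _); [exact: (key _ mpos)|exact: (key _ mneg)].
Qed.

End Processes.

(* Main.v *)
(** Let [Y i j] be the probability that a copy of the process started in [i] is
    still alive when an independent copy started in [j] is absorbed. As a matrix,
    [Y] is characterised by the Lyapunov equation [T Y + Y T^T = - e t^T], whose
    vectorised form is the linear system with matrix [kron_sum T T]. Observing the
    processes along the grid of mesh [2^-m] turns the probability into a finite
    sum of terms [C(nh) G C(nh)^T], with [C] the transition semigroup on the
    transient states, and telescoping [Y - C(h) Y C(h)^T] along the grid shows
    that this sum converges to [Y]; neither matrix exponentials nor integrals are
    needed. Conditional independence given the initial states makes the joint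
    probability for two coordinates a product, and since the coordinates have no
    atoms, Kendall's tau is [4 a - 1] with [a] the probability that both
    coordinates of one vector exceed those of the copy. *)

Require Import Defs.
From HB Require Import structures.
From mathcomp Require Import all_boot all_order all_algebra.
From mathcomp Require Import mxtens.
From mathcomp Require Import all_classical all_reals all_analysis.
From mathcomp Require Import zify ring lra.

Set Implicit Arguments.
Unset Strict Implicit.
Unset Printing Implicit Defensive.

Import Order.TTheory GRing.Theory Num.Theory.
Import numFieldNormedType.Exports.

Local Open Scope classical_set_scope.
Local Open Scope ring_scope.

(** * Substochastic semigroups *)

(** The transition semigroup restricted to the transient states; row sums may drop below 1 because
    mass leaks into the absorbing state. The analytic part of the proof uses nothing else about the
    process. *)
Record substochastic_semigroup {R : realType} {p : nat} (T : 'M[R]_p)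
    (C : R -> 'M[R]_p) : Prop := {
  ssg_ge0 : forall t i j, 0 <= t -> 0 <= C t i j ;
  ssg_sum_le1 : forall t i, 0 <= t -> \sum_j C t i j <= 1 ;
  ssg_zero : C 0 = 1%:M ;
  ssg_add : forall s t, 0 <= s -> 0 <= t -> C (s + t) = C s *m C t ;
  ssg_generator : forall i j,
    (C h i j - (i == j)%:R) / h @[h --> 0^'+] --> T i j
}.

(** Probability that the process started in [i] is not yet absorbed at time [t]. *)
Definition survival {R : realType} {p : nat} (C : R -> 'M[R]_p) (t : R)
  (i : 'I_p) : R := \sum_j C t i j.

(** Dyadic, so that each grid refines the previous one. *)
Definition mesh {R : realType} (m : nat) : R := 2^-1 ^+ m.

Section SubstochasticSemigroup.
Context {R : realType} {p : nat} {T : 'M[R]_p} {C : R -> 'M[R]_p}.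
Hypothesis subT : sub_intensity T.
Hypothesis unitT : T \in unitmx.
Hypothesis semiC : substochastic_semigroup T C.

Local Notation h m := (@mesh R m).
Local Notation S := (survival C).

Lemma mesh_gt0 m : 0 < h m.
Proof. by rewrite exprn_gt0 // invr_gt0. Qed.

Lemma mesh_ge0 m : 0 <= h m. Proof. exact/ltW/mesh_gt0. Qed.

Lemma grid_ge0 m (n : nat) : 0 <= n%:R * h m.
Proof. by rewrite mulr_ge0 ?mesh_ge0. Qed.

Lemma cvg_mesh : h m @[m --> \oo] --> (0 : R).
Proof.
apply: cvg_expr; rewrite ger0_norm ?invr_ge0 //.
by rewrite invf_lt1 // ltr1n.
Qed.

(** With [4 ^ m] cells the grid covers up to [2 ^+ m]: the mesh shrinks while the horizon grows. *)
Lemma grid_last m : (4 ^ m)%:R * h m = 2 ^+ m.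
Proof. by rewrite /mesh natrX -exprMn; congr (_ ^+ _); lra. Qed.

Lemma gridS m n : n.+1%:R * h m = n%:R * h m + h m.
Proof. by rewrite -natr1 mulrDl mul1r. Qed.

Lemma survival_ge0 t i : 0 <= t -> 0 <= S t i.
Proof. by move=> t0; apply: sumr_ge0 => j _; exact: (ssg_ge0 semiC). Qed.

Lemma survival_le1 t i : 0 <= t -> S t i <= 1.
Proof. exact: (ssg_sum_le1 semiC). Qed.

Lemma ssg_le_survival t i j : 0 <= t -> C t i j <= S t i.
Proof.
move=> t0; rewrite /survival (bigD1 j) //= lerDl.
by apply: sumr_ge0 => k _; exact: (ssg_ge0 semiC).
Qed.

Lemma survivalD s t i : 0 <= s -> 0 <= t ->
  S (s + t) i = \sum_a C s i a * S t a.
Proof.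
move=> s0 t0; rewrite /survival (ssg_add semiC) //.
under eq_bigr do rewrite mxE.
by rewrite exchange_big; under [RHS]eq_bigr do rewrite mulr_sumr.
Qed.

(* Minimum principle: at a minimal entry [u i < 0] the vector [T u = -1] would
   have a nonnegative entry. *)
Lemma expected_lifetime :
  exists u : 'I_p -> R, (forall i, 0 <= u i) /\
    forall i, \sum_j T i j * u j = -1.
Proof.
have [offd diag rows] := subT.
pose U : 'cV[R]_p := invmx T *m const_mx (-1).
have TU i : \sum_j T i j * U j ord0 = -1.
  have : (T *m U) i ord0 = -1 by rewrite /U mulKVmx // mxE.
  by rewrite mxE.
exists (fun i => U i ord0); split => // i.
rewrite leNgt; apply/negP => Ui.
case: (@arg_minP _ R _ i xpredT (fun i => U i ord0)) => // i0 _ minU.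
have Ui0 : U i0 ord0 < 0 by apply: le_lt_trans Ui; exact: minU.
suff : 0 <= \sum_j T i0 j * U j ord0 by rewrite TU; lra.
(* Replacing each [U j] by the minimum only lowers the sum, as off-diagonal entries are nonnegative;
   what remains is a nonpositive row sum times a negative number. *)
apply: (@le_trans _ _ (\sum_j T i0 j * U i0 ord0)).
  by rewrite -mulr_suml mulr_le0 // ltW.
apply: ler_sum => j _; have [->//|ne] := eqVneq j i0.
by apply: ler_wpM2l; [apply: offd; rewrite eq_sym|exact: minU].
Qed.

Lemma generator_mesh i j :
  (C (h m) i j - (i == j)%:R) / h m @[m --> \oo] --> T i j.
Proof.
have /cvg_at_rightP := @ssg_generator _ _ _ _ semiC i j; apply; split.
  exact: mesh_gt0.
exact: cvg_mesh.
Qed.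

Lemma cvg_mesh_id i j : C (h m) i j @[m --> \oo] --> ((i == j)%:R : R).
Proof.
have -> : (fun m => C (h m) i j) =
    (fun m => (C (h m) i j - (i == j)%:R) / h m * h m + (i == j)%:R).
  by apply/funext => m; rewrite divfK ?subrK // gt_eqF ?mesh_gt0.
rewrite -[X in _ --> X]add0r -[X in _ --> X + _](mulr0 (T i j)).
apply: cvgD; last exact: cvg_cst.
by apply: cvgM; [exact: generator_mesh|exact: cvg_mesh].
Qed.

Lemma cvg_fin_sum (I : finType) (f : I -> nat -> R) (l : I -> R) :
  (forall i, f i m @[m --> \oo] --> l i) ->
  \sum_i f i m @[m --> \oo] --> \sum_i l i.
Proof.
by move=> fl; apply: cvg_big => [|i _]; [exact: add_continuous|exact: fl].
Qed.

Lemma cvg_survival_mesh i : S (h m) i @[m --> \oo] --> (1 : R).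
Proof.
have -> : 1 = \sum_j (i == j)%:R :> R.
  rewrite (bigD1 i) //= eqxx big1 ?addr0 // => j.
  by rewrite eq_sym => /negPf ->.
by apply: cvg_fin_sum => j; exact: cvg_mesh_id.
Qed.

(* Under [T u = -1] the process [u (J_t)] loses at least [h / 2] per step of
   length [h] before absorption. *)
Lemma occupation_bound : exists u : 'I_p -> R, (forall i, 0 <= u i) /\
  \forall m \near \oo, forall N i,
    h m * \sum_(n < N) S (n%:R * h m) i <= 2 * u i.
Proof.
have [u [u0 Tu]] := expected_lifetime; exists u; split => //.
have drift i : \forall m \near \oo,
    \sum_j C (h m) i j * u j <= u i - h m / 2.
  have : \sum_j (C (h m) i j - (i == j)%:R) / h m * u j @[m --> \oo] --> (-1 : R).
    rewrite -(Tu i); apply: cvg_fin_sum => j.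
    by apply: cvgM; [exact: generator_mesh|exact: cvg_cst].
  move=> /cvgr_lt/(_ (- 2^-1)) drift.
  (* The gap between the limit [-1] and [- 2^-1] absorbs the [o(h)] error once the mesh is small. *)
  have lt12 : (-1 : R) < - 2^-1 by lra.
  near=> m.
  have : \sum_j (C (h m) i j - (i == j)%:R) / h m * u j < - 2^-1.
    by near: m; exact: drift.
  under eq_bigr do rewrite mulrAC.
  rewrite -mulr_suml ltr_pdivrMr ?mesh_gt0 //.
  under eq_bigr do rewrite mulrBl.
  rewrite sumrB [X in _ - X](bigD1 i) //= eqxx mul1r.
  rewrite [X in _ - (_ + X)]big1 ?addr0.
    lra.
  by move=> j /negPf; rewrite eq_sym => ->; rewrite mul0r.
have /filter_forall : forall i, \forall m \near \oo,
  \sum_j C (h m) i j * u j <= u i - h m / 2 by [].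
apply: filterS => m {}drift N i.
(* Strengthened for induction: the expected value of [u] left after [N] steps is kept, and each step
   trades part of it for occupation time. *)
suff : \sum_j C (N%:R * h m) i j * u j +
    h m / 2 * \sum_(n < N) S (n%:R * h m) i <= u i.
  have : 0 <= \sum_j C (N%:R * h m) i j * u j.
    by apply: sumr_ge0 => j _; rewrite mulr_ge0 ?(ssg_ge0 semiC) ?grid_ge0.
  lra.
elim: N => [|N IH].
  rewrite big_ord0 mulr0 addr0 mul0r (ssg_zero semiC) (bigD1 i) //= mxE eqxx.
  rewrite mul1r big1 ?addr0 // => j /negPf.
  by rewrite mxE eq_sym => ->; rewrite mul0r.
apply: le_trans IH; rewrite big_ord_recr /= mulrDr addrCA addrC addrC.
rewrite [leRHS]addrC lerD2l gridS (ssg_add semiC) ?grid_ge0 ?mesh_ge0 //.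
under eq_bigr do rewrite mxE mulr_suml.
rewrite exchange_big /= /survival mulr_sumr -big_split /=.
apply: ler_sum => a _.
under eq_bigr do rewrite -mulrA.
rewrite -mulr_sumr (mulrC (_ / 2)) -mulrDr.
apply: ler_wpM2l; first by rewrite (ssg_ge0 semiC) ?grid_ge0.
have := drift a; lra.
Unshelve. all: by end_near. Qed.

(** In the double sum, [C t i a] is bounded by [S t i] and [C t j b] only by 1. The surviving factor
    [S t i] makes such terms summable along the grid and negligible at the horizon. *)
Lemma conj_bound t (B : 'M[R]_p) i j : 0 <= t ->
  `|(C t *m B *m (C t)^T) i j| <= S t i * \sum_a \sum_b `|B a b|.
Proof.
move=> t0; rewrite mxE; under eq_bigr do rewrite 2!mxE mulr_suml.
rewrite exchange_big /=.
apply: le_trans (ler_norm_sum _ _ _) _; rewrite mulr_sumr.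
apply: ler_sum => a _.
apply: le_trans (ler_norm_sum _ _ _) _; rewrite mulr_sumr.
apply: ler_sum => b _; rewrite !normrM !(ger0_norm (ssg_ge0 semiC _ _ t0)).
apply: le_trans (_ : S t i * `|B a b| * 1 <= _); last by rewrite mulr1.
apply: ler_pM.
- by rewrite mulr_ge0 ?(ssg_ge0 semiC).
- exact: (ssg_ge0 semiC).
- by rewrite ler_wpM2r // ssg_le_survival.
- exact: le_trans (ssg_le_survival _ _ t0) (survival_le1 _ t0).
Qed.

(** Survival decreases in time, so each of the [4 ^ m] terms of the occupation sum is at least the
    last value; hence [2 ^+ m * S (2 ^+ m) i <= 2 * u i]. *)
Lemma cvg_survival_last i : S (2 ^+ m) i @[m --> \oo] --> (0 : R).
Proof.
have [u [u0 bound]] := occupation_bound.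
apply: (@squeeze_cvgr _ _ _ _ (fun=> 0) (fun m => 2 * u i * h m)).
- near=> m.
  rewrite survival_ge0 ?exprn_ge0 //=.
  have bm : h m * \sum_(n < 4 ^ m) S (n%:R * h m) i <= 2 * u i.
    by near: m; apply: filterS bound => m /(_ (4 ^ m)%N i).
  have : h m * \sum_(n < 4 ^ m) S (2 ^+ m) i <= 2 * u i.
    apply: le_trans bm; rewrite ler_wpM2l ?mesh_ge0 //.
    apply: ler_sum => n _.
    have le_n : (n%:R * h m : R) <= 2 ^+ m.
      by rewrite -grid_last ler_wpM2r ?mesh_ge0 // ler_nat ltnW.
    rewrite -(subrKC (n%:R * h m) (2 ^+ m)).
    rewrite survivalD ?grid_ge0 ?subr_ge0 //.
    apply: ler_sum => a _; rewrite -[leRHS]mulr1 ler_wpM2l //.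
      by rewrite (ssg_ge0 semiC) ?grid_ge0.
    by rewrite survival_le1 ?subr_ge0.
  rewrite sumr_const card_ord -[S _ _ *+ _]mulr_natl mulrA (mulrC (h m)) grid_last.
  by rewrite /mesh exprVn -ler_pdivlMl ?exprn_gt0 // [leRHS]mulrC.
- exact: cvg_cst.
- rewrite -[X in _ --> X](mulr0 (2 * u i)).
  by apply: cvgM; [exact: cvg_cst|exact: cvg_mesh].
Unshelve. all: by end_near. Qed.

(* Telescoping [Y - C(h) Y C(h)^T] along the grid; the error [E m = o(h)] is
   summed against a bounded occupation time. *)
Lemma lyapunov_grid_sum (Y F : 'M[R]_p) (G : nat -> 'M[R]_p) :
  T *m Y + Y *m T^T = - F ->
  (forall i j, G m i j / h m @[m --> \oo] --> F i j) ->
  forall i j, (\sum_(n < 4 ^ m) C (n%:R * h m) *m G m *m (C (n%:R * h m))^T) i j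
    @[m --> \oo] --> Y i j.
Proof.
move=> lyap cvgG i j.
pose E m := Y - C (h m) *m Y *m (C (h m))^T - G m.
have [u [u0 bound]] := occupation_bound.
have sumE m : \sum_(n < 4 ^ m) C (n%:R * h m) *m G m *m (C (n%:R * h m))^T =
    Y - C (2 ^+ m) *m Y *m (C (2 ^+ m))^T -
    \sum_(n < 4 ^ m) C (n%:R * h m) *m E m *m (C (n%:R * h m))^T.
  rewrite -grid_last.
  pose f n := C (n%:R * h m) *m Y *m (C (n%:R * h m))^T.
  have f0 : f 0%N = Y.
    by rewrite /f mul0r (ssg_zero semiC) mul1mx trmx1 mulmx1.
  rewrite -{1}f0 -[X in _ - X - _]/(f (4 ^ m)%N).
  rewrite -(opprB (f _)) -(telescope_sumr f (leq0n _)) big_mkord -sumrN -sumrB.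
  apply: eq_bigr => n _; rewrite /f /E.
  rewrite gridS (ssg_add semiC) ?grid_ge0 ?mesh_ge0 // trmx_mul.
  rewrite !mulmxBr !mulmxBl !mulmxA.
  by rewrite opprB subKr.
have cvgE a b : E m a b / h m @[m --> \oo] --> (0 : R).
  have EE m : E m a b / h m =
      - (\sum_c (\sum_e (C (h m) a e - (a == e)%:R) / h m * Y e c) *
           C (h m) b c)
      - \sum_c Y a c * ((C (h m) b c - (b == c)%:R) / h m) - G m a b / h m.
    (* Discrete product rule: each of the first two terms carries one increment of [C], so after
       division by [h m] the limit is [- T Y - Y T^T - F], which is 0. *)
    have -> : E m = - ((C (h m) - 1%:M) *m Y *m (C (h m))^T)
        - Y *m (C (h m) - 1%:M)^T - G m.
      rewrite /E linearB /= trmx1 mulmxBr mulmx1 !mulmxBl mul1mx opprB opprB.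
      by rewrite [X in _ = X - _]addrC addrA subrK.
    rewrite !mxE 2!mulrBl mulNr !mulr_suml; congr (- _ - _ - _).
      apply: eq_bigr => c _; rewrite !mxE mulrAC; congr (_ * _).
      by rewrite mulr_suml; apply: eq_bigr => e _; rewrite !mxE mulrAC.
    by apply: eq_bigr => c _; rewrite !mxE mulrA.
  rewrite (funext EE).
  have lim0 : 0 = - (\sum_c (\sum_e T a e * Y e c) * (b == c)%:R)
      - \sum_c Y a c * T b c - F a b.
    have := congr1 (fun B : 'M[R]_p => B a b) lyap; rewrite !mxE.
    under [X in _ + X = _ -> _]eq_bigr do rewrite mxE.
    move=> lyapE; rewrite (bigD1 b) //= eqxx mulr1 [X in - (_ + X)]big1.
      lra.
    by move=> c /negPf; rewrite eq_sym => ->; rewrite mulr0.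
  rewrite [X in _ --> X]lim0; apply: cvgB; first apply: cvgB; first apply: cvgN.
  - apply: cvg_fin_sum => c; apply: cvgM; last exact: cvg_mesh_id.
    apply: cvg_fin_sum => e.
    by apply: cvgM; [exact: generator_mesh|exact: cvg_cst].
  - apply: cvg_fin_sum => c.
    by apply: cvgM; [exact: cvg_cst|exact: generator_mesh].
  - exact: cvgG.
have cvgrho : (\sum_a \sum_b `|E m a b / h m|) @[m --> \oo] --> (0 : R).
  have lim0 : 0 = \sum_(a < p) \sum_(b < p) 0 :> R.
    by rewrite big1 // => a _; rewrite big1.
  rewrite [X in _ --> X]lim0.
  do 2!(apply: cvg_fin_sum => ?).
  by apply/norm_cvg0P; apply: cvgE.
have -> : (fun m => (\sum_(n < 4 ^ m) C (n%:R * h m) *m G m *m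
      (C (n%:R * h m))^T) i j) = (fun m => Y i j
    - (C (2 ^+ m) *m Y *m (C (2 ^+ m))^T) i j
    - (\sum_(n < 4 ^ m) C (n%:R * h m) *m E m *m (C (n%:R * h m))^T) i j).
  by apply/funext => m; rewrite sumE !mxE.
rewrite -[X in _ --> X]subr0 -[X in _ --> X - _]subr0.
apply: cvgB; first apply: cvgB; first exact: cvg_cst.
(* The boundary term at the horizon vanishes with the survival probability. *)
- apply/norm_cvg0P/(@squeeze_cvgr _ _ _ _ (fun=> 0)
    (fun m => S (2 ^+ m) i * \sum_a \sum_b `|Y a b|)).
  + by near=> m; rewrite normr_ge0 /= conj_bound // exprn_ge0.
  + exact: cvg_cst.
  + rewrite -[X in _ --> X](mul0r (\sum_a \sum_b `|Y a b|)).
    by apply: cvgM; [exact: cvg_survival_last|exact: cvg_cst].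
(* The accumulated error is at most the bounded occupation time multiplied by the vanishing sum of
   the [E m a b / h m] in absolute value. *)
- apply/norm_cvg0P/(@squeeze_cvgr _ _ _ _ (fun=> 0)
    (fun m => 2 * u i * \sum_a \sum_b `|E m a b / h m|)).
  + near=> m; rewrite normr_ge0 /= summxE.
    apply: le_trans (ler_norm_sum _ _ _) _.
    apply: (@le_trans _ _ (\sum_(n < 4 ^ m)
        S (n%:R * h m) i * \sum_a \sum_b `|E m a b|)).
      by apply: ler_sum => n _; rewrite conj_bound ?grid_ge0.
    have -> : \sum_a \sum_b `|E m a b| =
        h m * \sum_a \sum_b `|E m a b / h m|.
      rewrite mulr_sumr; apply: eq_bigr => a _; rewrite mulr_sumr.
      apply: eq_bigr => b _; rewrite normrM normfV (ger0_norm (mesh_ge0 m)).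
      by rewrite mulrCA divff ?mulr1 // gt_eqF ?mesh_gt0.
    rewrite -mulr_suml mulrA ler_wpM2r //.
      by do 2!(apply: sumr_ge0 => ? _).
    rewrite mulrC; near: m.
    by apply: filterS bound => m /(_ (4 ^ m)%N i).
  + exact: cvg_cst.
  + rewrite -[X in _ --> X](mulr0 (2 * u i)).
    by apply: cvgM; [exact: cvg_cst|exact: cvgrho].
Unshelve. all: by end_near. Qed.

End SubstochasticSemigroup.

(** * The Kronecker sum *)

(** The factor that one coordinate contributes to the formula for tau; [cvg_overtake] gives its
    probabilistic meaning. *)
Definition overtake {R : realType} {p : nat} (T : 'M[R]_p) (i j : 'I_p) : R :=
  (((basis_vec i)^T *t (basis_vec j)^T) *m invmx (- kron_sum T T) *m
     (ones *t exit_rates T)) ord0 ord0.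

Section KroneckerSum.
Context {R : realType} {p : nat} (T : 'M[R]_p).

Lemma cvg_pointwise_cst (u : nat -> R) (c : R) :
  (forall m, u m = c) -> u m @[m --> \oo] --> c.
Proof. by move=> uc; rewrite (funext uc); exact: cvg_cst. Qed.

Lemma onesE (i : 'I_p) k : ones i k = 1 :> R.
Proof.
rewrite /ones summxE (bigD1 i) //= ord1 mxE !eqxx big1 ?addr0 // => j ji.
by rewrite mxE eq_sym (negPf ji).
Qed.

Lemma exit_ratesE i k : exit_rates T i k = - \sum_j T i j.
Proof.
rewrite mxE -sumrN; apply: eq_bigr => j _.
by rewrite onesE mulr1 mxE.
Qed.

Lemma sum_mxtens_index (m n : nat) (f : 'I_(m * n) -> R) :
  \sum_k f k = \sum_(i < m) \sum_(j < n) f (mxtens_index (i, j)).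
Proof.
rewrite pair_bigA (reindex (@mxtens_index m n)) /=.
  by apply: eq_bigr => -[].
exists (@mxtens_unindex m n) => x _; first exact: mxtens_indexK.
exact: mxtens_unindexK.
Qed.

Definition unvec (z : 'cV[R]_(p * p)) : 'M[R]_p :=
  \matrix_(i, j) z (mxtens_index (i, j)) ord0.

(** Acting on the first tensor index is left multiplication by [T]; acting on the second is right
    multiplication by [T^T]. *)
Lemma kron_sum_unvec z :
  unvec (kron_sum T T *m z) = T *m unvec z + unvec z *m T^T.
Proof.
apply/matrixP => i j; rewrite !mxE sum_mxtens_index.
under eq_bigr do under eq_bigr do rewrite mxE !tensmxE !mxE mulrDl.
under eq_bigr do rewrite big_split /=.
rewrite big_split /=; congr (_ + _).
  apply: eq_bigr => a _; rewrite (bigD1 j) //= eqxx mulr1 big1 ?addr0 ?mxE //.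
  by move=> b; rewrite eq_sym => /negPf ->; rewrite mulr0 mul0r.
rewrite (bigD1 i) //= eqxx [X in _ + X]big1 ?addr0.
  by apply: eq_bigr => b _; rewrite mul1r !mxE mulrC.
by move=> a; rewrite eq_sym => /negPf ->; rewrite big1 // => b _; rewrite !mul0r.
Qed.

Hypothesis subT : sub_intensity T.
Hypothesis unitT : T \in unitmx.
Context {C : R -> 'M[R]_p}.
Hypothesis semiC : substochastic_semigroup T C.

(** Take [F] and [G] zero in [lyapunov_grid_sum]: the grid sums vanish identically, yet converge to
    [Y]. *)
Lemma lyapunov_inj (Y : 'M[R]_p) : T *m Y + Y *m T^T = 0 -> Y = 0.
Proof.
rewrite -[X in _ = X -> _]oppr0 => lyap; apply/matrixP => i j; rewrite mxE.
have cvg0 (a b : 'I_p) :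
    (0 : 'M[R]_p) a b / mesh m @[m --> \oo] --> (0 : 'M[R]_p) a b.
  by rewrite mxE; apply: cvg_pointwise_cst => m; rewrite mul0r.
have := @lyapunov_grid_sum _ _ _ _ subT unitT semiC _ _ (fun=> 0) lyap cvg0 i j.
move=> /(cvg_unique (@Rhausdorff R)); apply; apply: cvg_pointwise_cst => m.
by rewrite big1 ?mxE // => n _; rewrite mulmx0 mul0mx.
Qed.

(** Injectivity of the Lyapunov operator replaces any eigenvalue argument. It ensures that [invmx]
    is here a true inverse and not its default value. *)
Lemma kron_sum_unit : - kron_sum T T \in unitmx.
Proof.
rewrite -unitmx_tr -row_free_unit; apply: inj_row_free => z zA.
have /(congr1 unvec) : kron_sum T T *m z^T = 0.
  by apply: oppr_inj; rewrite -mulNmx oppr0 -[LHS]trmxK trmx_mul trmxK zA trmx0.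
rewrite kron_sum_unvec (_ : unvec 0 = 0); last first.
  by apply/matrixP => i j; rewrite !mxE.
move=> /lyapunov_inj /matrixP z0; apply/rowP => k.
case: (mxtens_indexP k) => i j.
by have := z0 i j; rewrite !mxE => <-.
Qed.

Lemma overtake_lyapunov :
  T *m (\matrix_(i, j) overtake T i j) + (\matrix_(i, j) overtake T i j) *m T^T
  = - (ones *m (exit_rates T)^T).
Proof.
pose z := invmx (- kron_sum T T) *m (ones *t exit_rates T).
have -> : \matrix_(i, j) overtake T i j = unvec z.
  apply/matrixP => i j; rewrite [LHS]mxE [RHS]mxE /overtake.
  rewrite -mulmxA -/z mxE.
  (* The tensor of two basis rows selects the coordinate [(i, j)]. *)
  have rowE a b : ((basis_vec i)^T *t (basis_vec j)^T : 'M[R]_(_, p * p)) ord0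
      (mxtens_index (a, b)) = ((a == i) && (b == j))%:R.
    by rewrite !mxE mxtens_indexK !ord1 !eqxx !andbT -natrM mulnb.
  rewrite sum_mxtens_index (bigD1 i) //= (bigD1 j) //= rowE !eqxx mul1r.
  rewrite [X in _ + X + _]big1 => [|b bj]; last first.
    by rewrite rowE (negPf bj) andbF mul0r.
  rewrite addr0 big1 ?addr0 // => a ai.
  by rewrite big1 // => b _; rewrite rowE (negPf ai) mul0r.
rewrite -kron_sum_unvec.
have -> : kron_sum T T *m z = - (ones *t exit_rates T).
  by rewrite -[kron_sum T T]opprK mulNmx /z mulKVmx ?kron_sum_unit.
apply/matrixP => i j; rewrite !mxE big_ord1 !mxE !mxtens_indexK.
by rewrite !ord1.
Qed.

(** The [n]-th summand is the probability that the copy from [j] is absorbed in cell [n] and the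
    copy from [i] outlives that cell. *)
Lemma cvg_overtake i j :
  \sum_(n < 4 ^ m) survival C (n.+1%:R * mesh m) i *
    (survival C (n%:R * mesh m) j - survival C (n.+1%:R * mesh m) j)
    @[m --> \oo] --> overtake T i j.
Proof.
(* The same probability for the first cell; conjugating with [C] at time [n%:R * mesh m] moves it to
   cell [n]. *)
pose G m : 'M[R]_p := \matrix_(a, b)
  (survival C (mesh m) a * (1 - survival C (mesh m) b)).
have cvgG a b : G m a b / mesh m @[m --> \oo] -->
    (ones *m (exit_rates T)^T) a b.
  rewrite mxE big_ord1 onesE [_^T _ _]mxE exit_ratesE.
  have GE m : G m a b / mesh m = survival C (mesh m) a *
      - \sum_c (C (mesh m) b c - (b == c)%:R) / mesh m.
    rewrite mxE -mulrA; congr (_ * _).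
    rewrite -mulr_suml sumrB -mulNr opprB; congr (_ / _); congr (_ - _).
    rewrite (bigD1 b) //= eqxx big1 ?addr0 // => c.
    by rewrite eq_sym => /negPf ->.
  rewrite (funext GE).
  apply: cvgM.
    exact: (cvg_survival_mesh semiC).
  by apply: cvgN; apply: cvg_fin_sum => c; exact: (generator_mesh semiC).
have gridE m : (\sum_(n < 4 ^ m) C (n%:R * mesh m) *m G m *m
      (C (n%:R * mesh m))^T) i j =
    \sum_(n < 4 ^ m) survival C (n.+1%:R * mesh m) i *
    (survival C (n%:R * mesh m) j - survival C (n.+1%:R * mesh m) j).
  rewrite summxE; apply: eq_bigr => n _; rewrite mxE.
  have h0 := @mesh_ge0 R m; have nh0 := @grid_ge0 R m n.
  have sumM : survival C (n%:R * mesh m) j - survival C (n.+1%:R * mesh m) j =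
      \sum_b (1 - survival C (mesh m) b) * C (n%:R * mesh m) j b.
    rewrite gridS (survivalD semiC) // -sumrB; apply: eq_bigr => b _.
    by rewrite mulrBl mul1r [_ * survival _ _ _]mulrC.
  rewrite sumM mulr_sumr; apply: eq_bigr => b _.
  rewrite !mxE mulrA; congr (_ * _).
  rewrite gridS (survivalD semiC) // mulr_suml.
  by apply: eq_bigr => a _; rewrite mxE mulrA.
have := @lyapunov_grid_sum _ _ _ _ subT unitT semiC _ _ G
  overtake_lyapunov cvgG i j.
by rewrite (funext gridE) mxE.
Qed.

End KroneckerSum.

(** * Product measure and dyadic grids *)

Section AlmostEverywhere.
Context {d : measure_display} {U : measurableType d} {R : realType}.
Variable mu : {measure set U -> \bar R}.

(** Needed because events on absorption times agree with events on states only almost everywhere. *)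
Lemma ae_measure_eq (A B : set U) : measurable A -> measurable B ->
  {ae mu, forall x, A x <-> B x} -> mu A = mu B.
Proof.
have le C D : measurable C -> measurable D ->
    {ae mu, forall x, C x <-> D x} -> (mu C <= mu D)%E.
  move=> mC mD [N [mN N0 subN]].
  rewrite -[leRHS]adde0 -N0; apply: (@le_trans _ _ (mu (D `|` N))).
    apply: le_measure; rewrite ?inE //; first exact: measurableU.
    move=> x Cx; have [Dx|nDx] := pselect (D x); [by left|right].
    by apply: subN => /= -[/(_ Cx)].
  exact: measureU2.
move=> mA mB AB; apply/eqP; rewrite eq_le !le //.
by apply: filterS AB => x [AB BA]; split.
Qed.

End AlmostEverywhere.

Section ProductMeasure.
Context {d : measure_display} {Om : measurableType d} {R : realType}.
Variable P : probability Om R.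

Lemma product_rectE (A B : set Om) : measurable A -> measurable B ->
  (P \x P)%E (A `*` B) = (P A * P B)%E.
Proof. exact: product_measure1E. Qed.

Lemma product_measure_swap (A : set (Om * Om)) : measurable A ->
  (P \x P)%E [set w | A (w.2, w.1)] = (P \x P)%E A.
Proof.
move=> mA.
have mswap : measurable_fun setT (fun w : Om * Om => (w.2, w.1)).
  by apply/measurable_fun_pairP; split;
    [exact: measurable_snd|exact: measurable_fst].
symmetry; apply: (@product_measure_unique _ _ _ _ _ P P
  (measure_function_pushforward__canonical__measure_function_Measure
    (P \x P)%E mswap)) => // B D mB mD.
rewrite /= /pushforward.
rewrite (_ : _ @^-1` _ = D `*` B); first by rewrite product_rectE // muleC.
by apply/seteqP; split => w /= [].
Qed.

Lemma ae_prod1 (Q : Om -> Prop) : {ae P, forall w, Q w} ->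
  {ae (P \x P)%E, forall w, Q w.1}.
Proof.
move=> [N [mN N0 subN]]; exists (N `*` setT); split.
- exact: measurableX.
- by rewrite product_rectE // N0 mul0e.
- by move=> w nQ; split => //; exact: subN.
Qed.

Lemma ae_prod2 (Q : Om -> Prop) : {ae P, forall w, Q w} ->
  {ae (P \x P)%E, forall w, Q w.2}.
Proof.
move=> [N [mN N0 subN]]; exists (setT `*` N); split.
- exact: measurableX.
- by rewrite product_rectE // N0 mule0.
- by move=> w nQ; split => //; exact: subN.
Qed.

Lemma ae_neq_of_no_atom (X : {RV P >-> R}) :
  (forall x, P [set w | X w = x] = 0%E) ->
  {ae (P \x P)%E, forall w, X w.1 != X w.2}.
Proof.
move=> noatom.
have mD : measurable_fun setT (fun w : Om * Om => X w.1 - X w.2).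
  apply: measurable_realfun.measurable_funB.
  - exact: (measurableT_comp _ measurable_fst).
  - exact: (measurableT_comp _ measurable_snd).
exists [set w | X w.1 = X w.2]; split.
- rewrite (_ : [set w | _] = setT `&` (fun w => X w.1 - X w.2) @^-1` [set 0]).
    exact: mD.
  rewrite setTI; apply/seteqP; split => w /=; first by move=> ->; rewrite subrr.
  by move/eqP; rewrite subr_eq0 => /eqP.
(* The section of the diagonal at [w] is the event that [X] takes the value [X w], which is null. *)
- rewrite /product_measure1; apply: integral0_eq => w _ /=.
  rewrite -[RHS](noatom (X w)); congr (P _).
  apply/seteqP; split => w' /=; rewrite xsectionE /= /mkset.
    by move=> ->.
  by move=> ->.
- by move=> w /= /negP; rewrite negbK => /eqP.
Qed.

End ProductMeasure.

(** * The strict order of two reals, detected on dyadic grids *)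

Section GridOrder.
Context {R : realType}.
Local Notation h m := (@mesh R m).

(** Some cell contains [z] and ends before [x]. Cells are open on the left to match the strict
    inequality in survival functions, and finite in number so that the event is a finite union of
    rectangles. *)
Definition grid_lt (m : nat) (z x : R) := exists2 n, (n < 4 ^ m)%N &
  n%:R * h m < z <= n.+1%:R * h m /\ n.+1%:R * h m < x.

Lemma mesh_double m : h m = 2 * h m.+1.
Proof. by rewrite /mesh exprS mulrA divff ?mul1r. Qed.

(** Cell [n] splits into cells [2n] and [2n + 1], one of which contains [z]; neither reaches [x]. *)
Lemma grid_ltS m z x : grid_lt m z x -> grid_lt m.+1 z x.
Proof.
move=> [n n4 [/andP[nz zn] nx]].
have h0 := @mesh_gt0 R m.+1.
move: nz zn nx; rewrite mesh_double -!natr1 => nz zn nx.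
have [zle|zgt] := leP z ((2 * n).+1%:R * h m.+1).
  exists (2 * n)%N; first by rewrite expnS; nia.
  by move: zle; rewrite -!natr1 natrM => zle; split; [apply/andP; split|]; nra.
exists (2 * n).+1; first by rewrite expnS; nia.
by move: zgt; rewrite -!natr1 natrM => zgt; split; [apply/andP; split|]; nra.
Qed.

Lemma grid_lt_mono z x : {homo (fun m => grid_lt m z x) : m n / (m <= n)%N >-> m -> n}.
Proof.
move=> m n /subnK <-; elim: (n - m)%N => [//|k IH] mzx.
by rewrite addSn; apply/grid_ltS/IH.
Qed.

Lemma grid_ltP z x : (exists m, grid_lt m z x) <-> 0 < z < x.
Proof.
split=> [[m [n _ [/andP[nz zn] nx]]]|/andP[z0 zx]].
  by rewrite (le_lt_trans (grid_ge0 m n) nz) (le_lt_trans zn nx).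
(* A mesh below [x - z] makes the cell of [z] end before [x]; a mesh below [z^-1] puts [z] within
   the horizon [2 ^+ m]. *)
have [m hm] : exists m, h m < Num.min (x - z) z^-1.
  have : \forall m \near \oo, h m < Num.min (x - z) z^-1.
    by apply: (cvgr_lt _ cvg_mesh); rewrite lt_min subr_gt0 zx invr_gt0.
  exact: filter_ex.
move: hm; rewrite lt_min => /andP[hx hz].
have h0 := @mesh_gt0 R m.
have zm : z <= 2 ^+ m.
  by rewrite -lef_pV2 ?posrE ?exprn_gt0 // -exprVn ltW.
exists m.
have ex : exists n, z <= n.+1%:R * h m.
  exists (4 ^ m)%N; rewrite gridS grid_last.
  by apply: le_trans zm _; rewrite lerDl ltW.
(* The least cell whose right end reaches [z] contains [z], by minimality. *)
case: (ex_minnP ex) => n zn nmin.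
have nz : n%:R * h m < z.
  case: n zn nmin => [|n] zn nmin; first by rewrite mul0r.
  by rewrite ltNge; apply/negP => /nmin; rewrite ltnn.
exists n; last by rewrite nz zn gridS; split => //; lra.
rewrite -(ltr_nat R) -(ltr_pM2r h0) grid_last.
exact: lt_le_trans nz zm.
Qed.

Lemma grid_lt_uniq m (n n' : nat) (z : R) :
  n%:R * h m < z <= n.+1%:R * h m -> n'%:R * h m < z <= n'.+1%:R * h m ->
  n = n'.
Proof.
move=> /andP[a b] /andP[a' b']; apply/eqP.
have := lt_le_trans a b'; have := lt_le_trans a' b.
by rewrite !ltr_pM2r ?mesh_gt0 // !ltr_nat !ltnS eqn_leq => -> ->.
Qed.

End GridOrder.

(** * Kendall's tau from joint survival functions *)

Lemma measure_finType_bigcup {d : measure_display} {U : measurableType d}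
    {R : realType} (mu : {measure set U -> \bar R}) (I : finType)
    (F : I -> set U) :
  (forall i, measurable (F i)) ->
  (forall i j x, F i x -> F j x -> i = j) ->
  mu (\bigcup_i F i) = (\sum_i mu (F i))%E.
Proof.
move=> mF injF; rewrite measure_fin_bigcup; first last.
- by move=> i _; exact: mF.
- by move=> i j _ _ [x [Fi Fj]]; exact: injF Fi Fj.
- exact: finite_finset.
rewrite [RHS]fsbig_seq ?index_enum_uniq //.
by apply: eq_fsbigl; apply/seteqP; split => i _ //=; rewrite mem_index_enum.
Qed.

Section KendallFromSurvival.
Context {d : measure_display} {Om : measurableType d} {R : realType} {p : nat}.
Context {P : probability Om R}.
Local Notation h m := (@mesh R m).

Section RealVariable.
Variable X : {RV P >-> R}.

Lemma measurable_RV_gt a : measurable [set w | a < X w].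
Proof.
rewrite (_ : [set w | _] = setT `&` X @^-1` `]a, +oo[).
  exact: measurable_funP.
by rewrite setTI; apply/seteqP; split => w /=; rewrite in_itv /= andbT.
Qed.

Lemma measurable_RV_itv a b : measurable [set w | a < X w <= b].
Proof.
rewrite (_ : [set w | _] = setT `&` X @^-1` `]a, b]).
  exact: measurable_funP.
by rewrite setTI; apply/seteqP; split => w /=; rewrite in_itv.
Qed.

(** The event [E] carries the constraints on the other variables, so a rectangle is treated one side
    at a time. *)
Lemma prob_RV_itv a b (E : set Om) : measurable E -> a <= b ->
  P ([set w | a < X w <= b] `&` E) =
  (P ([set w | (a < X w)%R] `&` E) - P ([set w | (b < X w)%R] `&` E))%E.
Proof.
move=> mE ab; have mI c := measurableI _ _ (measurable_RV_gt c) mE.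
rewrite (_ : [set w | a < X w <= b] `&` E = ([set w | a < X w] `&` E) `\`
    ([set w | b < X w] `&` E)); last first.
  apply/seteqP; split => w /=.
    by move=> [/andP[aX Xb] Ew]; split => // -[bX _]; rewrite leNgt bX in Xb.
  move=> [[aX Ew] nbX]; split => //; rewrite aX /= leNgt; apply/negP => bX.
  exact: nbX.
rewrite measureD //; last exact: le_lt_trans (probability_le1 P (mI a)) (ltry _).
congr (_ - P _)%E; apply/seteqP; split => w /=; first by move=> [].
by move=> [bX Ew]; do !split => //; exact: le_lt_trans bX.
Qed.

End RealVariable.

Context {X1 X2 : {RV P >-> R}} {J0 : Om -> 'I_p} {v : 'I_p -> R}
  {S1 S2 : R -> 'I_p -> R} {Y1 Y2 : 'I_p -> 'I_p -> R}.
Hypothesis mJ0 : forall j, measurable [set w | J0 w = j].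
Hypothesis joint : forall j s t, 0 <= s -> 0 <= t ->
  P ([set w | s < X1 w] `&` ([set w | t < X2 w] `&` [set w | J0 w = j])) =
  (v j * (S1 s j * S2 t j))%:E.
Hypothesis cvgY1 : forall i j, \sum_(n < 4 ^ m) S1 (n.+1%:R * mesh m) i *
    (S1 (n%:R * mesh m) j - S1 (n.+1%:R * mesh m) j) @[m --> \oo] --> Y1 i j.
Hypothesis cvgY2 : forall i j, \sum_(n < 4 ^ m) S2 (n.+1%:R * mesh m) i *
    (S2 (n%:R * mesh m) j - S2 (n.+1%:R * mesh m) j) @[m --> \oo] --> Y2 i j.

Lemma prob_rectangle j a b c e : 0 <= a -> a <= b -> 0 <= c -> c <= e ->
  P ([set w | a < X1 w <= b] `&`
     ([set w | c < X2 w <= e] `&` [set w | J0 w = j])) =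
  (v j * ((S1 a j - S1 b j) * (S2 c j - S2 e j)))%:E.
Proof.
move=> a0 ab c0 ce; have b0 := le_trans a0 ab; have e0 := le_trans c0 ce.
have mI t : measurable ([set w | t < X1 w] `&` [set w | J0 w = j]).
  exact: measurableI (measurable_RV_gt X1 t) (mJ0 j).
rewrite prob_RV_itv //; last exact: measurableI (measurable_RV_itv X2 c e) _.
rewrite !(setICA [set w | _ < X1 w]) !(prob_RV_itv X2) //.
rewrite !(setICA [set w | _ < X2 w]) !joint //.
by rewrite -!EFinB; congr (_%:E); ring.
Qed.

(** Split by the two initial states, given which the coordinates are independent. Positivity is
    included because the grid starts at 0. *)
Definition both_later (i j : 'I_p) : set (Om * Om) :=
  [set w | [/\ 0 < X1 w.2 < X1 w.1, 0 < X2 w.2 < X2 w.1, J0 w.1 = i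
    & J0 w.2 = j]].

Definition grid_later (i j : 'I_p) (m : nat) : set (Om * Om) :=
  [set w | [/\ grid_lt m (X1 w.2) (X1 w.1), grid_lt m (X2 w.2) (X2 w.1),
    J0 w.1 = i & J0 w.2 = j]].

(** The pair [q] records the cells of the two coordinates of the second copy; fixing it decouples
    the two copies into a product set. *)
Definition grid_rect (i j : 'I_p) (m : nat) (q : 'I_(4 ^ m) * 'I_(4 ^ m)) :
    set (Om * Om) :=
  ([set w | q.1.+1%:R * h m < X1 w] `&`
     ([set w | q.2.+1%:R * h m < X2 w] `&` [set w | J0 w = i])) `*`
  ([set w | q.1%:R * h m < X1 w <= q.1.+1%:R * h m] `&`
     ([set w | q.2%:R * h m < X2 w <= q.2.+1%:R * h m] `&`
      [set w | J0 w = j])).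

Lemma grid_laterE i j m : grid_later i j m = \bigcup_q @grid_rect i j m q.
Proof.
apply/seteqP; split => [w [[n n4 [zn nx]] [n' n'4 [zn' nx']] Ji Jj]|].
  by exists (Ordinal n4, Ordinal n'4).
move=> w [[n n'] _ [[/= nx [nx' Ji]] [/= zn [zn' Jj]]]].
by split => //; [exists n|exists n'].
Qed.

Lemma measurable_grid_rect i j m q : measurable (@grid_rect i j m q).
Proof.
apply: measurableX.
  apply: measurableI; first exact: measurable_RV_gt.
  by apply: measurableI => //; exact: measurable_RV_gt.
apply: measurableI; first exact: measurable_RV_itv.
by apply: measurableI => //; exact: measurable_RV_itv.
Qed.

Lemma measurable_grid_later i j m : measurable (grid_later i j m).
Proof.
rewrite grid_laterE; apply: fin_bigcup_measurable => // q _.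
exact: measurable_grid_rect.
Qed.

(** Given the initial states each rectangle has a product probability, so the double sum over cell
    pairs splits into one sum per coordinate. *)
Lemma prob_grid_later i j m : (P \x P)%E (grid_later i j m) =
  (v i * v j *
   ((\sum_(n < 4 ^ m) S1 (n.+1%:R * mesh m) i *
      (S1 (n%:R * mesh m) j - S1 (n.+1%:R * mesh m) j)) *
    (\sum_(n < 4 ^ m) S2 (n.+1%:R * mesh m) i *
      (S2 (n%:R * mesh m) j - S2 (n.+1%:R * mesh m) j))))%:E.
Proof.
rewrite grid_laterE measure_finType_bigcup; first last.
- move=> [n1 n2] [n1' n2'] w [_ [/= a [b _]]] [_ [/= a' [b' _]]].
  by congr (_, _); apply/val_inj; [exact: grid_lt_uniq a a'|
    exact: grid_lt_uniq b b'].
- exact: measurable_grid_rect.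
have leS (n : nat) : n%:R * h m <= n.+1%:R * h m.
  by rewrite gridS lerDl mesh_ge0.
rewrite big_distrlr /= pair_bigA /= mulr_sumr -sumEFin.
apply: eq_bigr => -[n1 n2] _ /=.
rewrite product_rectE.
- by rewrite joint ?grid_ge0 // prob_rectangle ?grid_ge0 // -EFinM; congr _%:E; ring.
- apply: measurableI; first exact: measurable_RV_gt.
  by apply: measurableI => //; exact: measurable_RV_gt.
- apply: measurableI; first exact: measurable_RV_itv.
  by apply: measurableI => //; exact: measurable_RV_itv.
Qed.

Lemma both_laterE i j : both_later i j = \bigcup_m grid_later i j m.
Proof.
apply/seteqP; split => w.
  move=> [/grid_ltP[m1 lt1] /grid_ltP[m2 lt2] Ji Jj].
  exists (maxn m1 m2) => //; split => //.
    exact: grid_lt_mono (leq_maxl _ _) lt1.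
  exact: grid_lt_mono (leq_maxr _ _) lt2.
by move=> [m _ [lt1 lt2 Ji Jj]]; split => //; apply/grid_ltP; exists m.
Qed.

Lemma measurable_both_later i j : measurable (both_later i j).
Proof.
rewrite both_laterE; apply: bigcup_measurable => m _.
exact: measurable_grid_later.
Qed.

(** Continuity from below along the increasing grid events, compared with the limits [Y1] and
    [Y2]. *)
Lemma prob_both_later i j :
  (P \x P)%E (both_later i j) = (v i * v j * (Y1 i j * Y2 i j))%:E.
Proof.
have : (P \x P)%E (grid_later i j m) @[m --> \oo] --> (P \x P)%E (both_later i j).
  rewrite both_laterE; apply: nondecreasing_cvg_mu.
  - exact: measurable_grid_later.
  - by rewrite -both_laterE; exact: measurable_both_later.
  - move=> m n mn; apply/subsetPset => w [lt1 lt2 Ji Jj].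
    by split => //; [exact: grid_lt_mono mn lt1|exact: grid_lt_mono mn lt2].
move/cvg_unique; apply; first exact: ereal_hausdorff.
rewrite (funext (prob_grid_later i j)); apply: cvg_EFin; first exact: nearW.
by apply: cvgM; [exact: cvg_cst|apply: cvgM].
Qed.

Hypothesis pos1 : {ae P, forall w, 0 < X1 w}.
Hypothesis pos2 : {ae P, forall w, 0 < X2 w}.
Hypothesis no_atom1 : forall x, P [set w | X1 w = x] = 0%E.
Hypothesis no_atom2 : forall x, P [set w | X2 w = x] = 0%E.

(** Concordance is almost everywhere the disjoint union of [W] and its mirror image [W'], of mass
    [2a]. Without ties discordance is the complement, of mass [1 - 2a]. *)
Lemma kendall_tau_survival : kendall_tau X1 X2 =
  4 * (\sum_i \sum_j v i * v j * Y1 i j * Y2 i j) - 1.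
Proof.
set a := \sum_i _.
pose W : set (Om * Om) := \bigcup_(q : 'I_p * 'I_p) both_later q.1 q.2.
pose W' : set (Om * Om) := [set w | W (w.2, w.1)].
have mW : measurable W.
  by apply: fin_bigcup_measurable => // q _; exact: measurable_both_later.
have mW' : measurable W'.
  have mswap : measurable_fun setT (fun w : Om * Om => (w.2, w.1)).
    by apply/measurable_fun_pairP; split;
      [exact: measurable_snd|exact: measurable_fst].
  by rewrite /W' -[X in measurable X]setTI; exact: mswap.
have WE w : W w <-> 0 < X1 w.2 < X1 w.1 /\ 0 < X2 w.2 < X2 w.1.
  split; first by move=> [q _ []].
  by move=> [lt1 lt2]; exists (J0 w.1, J0 w.2).
have muW : (P \x P)%E W = a%:E.
  rewrite measure_finType_bigcup; last 2 first.
  - by move=> q; exact: measurable_both_later.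
  - by move=> [i j] [i' j'] w [_ _ /= <- <-] [_ _ /= <- <-].
  rewrite /a pair_bigA -sumEFin; apply: eq_bigr => q _.
  by rewrite -mulrA; exact: prob_both_later.
have muW' : (P \x P)%E W' = a%:E by rewrite product_measure_swap.
have muU : (P \x P)%E (W `|` W') = (a + a)%:E.
  have disj : W `&` W' = set0.
    apply/seteqP; split => // w [/WE[/andP[_ lt1] _] /WE[/andP[_]]] /=.
    by rewrite ltNge ltW.
  transitivity ((P \x P)%E W + (P \x P)%E W')%E; first exact: measureU.
  by rewrite muW muW'.
have mf : measurable_fun setT
    (fun w : Om * Om => (X1 w.1 - X1 w.2) * (X2 w.1 - X2 w.2)).
  by apply: measurable_realfun.measurable_funM;
    apply: measurable_realfun.measurable_funB;
    (exact: (measurableT_comp _ measurable_fst) ||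
     exact: (measurableT_comp _ measurable_snd)).
have generic : {ae (P \x P)%E, forall w, [/\ 0 < X1 w.1, 0 < X1 w.2,
    0 < X2 w.1 & 0 < X2 w.2] /\ X1 w.1 != X1 w.2 /\ X2 w.1 != X2 w.2}.
  have p11 := ae_prod1 pos1; have p12 := ae_prod2 pos1.
  have p21 := ae_prod1 pos2; have p22 := ae_prod2 pos2.
  have n1 := ae_neq_of_no_atom no_atom1; have n2 := ae_neq_of_no_atom no_atom2.
  by near=> w; do !split; near: w.
have UE : {ae (P \x P)%E, forall w,
    0 < (X1 w.1 - X1 w.2) * (X2 w.1 - X2 w.2) <-> (W `|` W') w}.
  apply: filterS generic => w [[x1 y1 x2 y2] [ne1 ne2]].
  rewrite /setU /W' /= !WE /= x1 y1 x2 y2 /=.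
  move: ne1 ne2; rewrite !neq_lt => /orP[lt1|lt1] /orP[lt2|lt2];
    split => [|[[]|[]]]; nra.
pose f (w : Om * Om) := (X1 w.1 - X1 w.2) * (X2 w.1 - X2 w.2).
have mpos : measurable [set w | 0 < f w].
  rewrite (_ : [set w | _] = setT `&` f @^-1` `]0, +oo[); first exact: mf.
  by rewrite set_itvoy setTI.
have mneg : measurable [set w | f w < 0].
  rewrite (_ : [set w | _] = setT `&` f @^-1` `]-oo, 0[); first exact: mf.
  by rewrite set_itvNyo setTI.
have mU : measurable (W `|` W') by exact: measurableU.
have muPos : (P \x P)%E [set w | 0 < f w] = (a + a)%:E.
  by rewrite -muU; apply: ae_measure_eq.
have muNeg : (P \x P)%E [set w | f w < 0] = (1 - (a + a))%:E.
  transitivity ((P \x P)%E (~` (W `|` W'))).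
    apply: ae_measure_eq => //; first exact: measurableC.
    apply: filterS2 generic UE => w [_ [ne1 ne2]] Uw.
    split=> [fw /Uw f0|nU]; first by have := lt_trans f0 fw; rewrite ltxx.
    have : f w != 0 by rewrite mulf_neq0 // subr_eq0.
    by rewrite neq_lt => /orP[|/Uw/nU].
  by rewrite EFinB -muU; exact: probability_setC.
by rewrite /kendall_tau muPos muNeg /=; ring.
Unshelve. all: by end_near. Qed.

End KendallFromSurvival.

(** * Absorption times of Markov jump processes *)

Section TransitionFunction.
Context {R : realType} {p : nat} {T : 'M[R]_p} {Pt : R -> 'M[R]_(p + 1)}.
Hypothesis tf : transition_function (full_intensity T) Pt.
Local Notation abs := (@absorbing_state p).
Local Notation tr := (@transient_state p).

Lemma sum_states (f : 'I_(p + 1) -> R) : \sum_s f s = \sum_i f (tr i) + f abs.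
Proof. by rewrite big_split_ord /= big_ord1. Qed.

(* [1 - Pt t abs abs] is subadditive in [t] and has derivative [0] at [0]. *)
Lemma tf_absorbing t : 0 <= t -> Pt t abs abs = 1.
Proof.
pose q s := 1 - Pt s abs abs.
have q_ge0 s : 0 <= s -> 0 <= q s.
  move=> s0; rewrite subr_ge0 -(tf_sum1 tf abs s0) sum_states lerDr.
  by apply: sumr_ge0 => i _; exact: (tf_ge0 tf).
have q2 s : 0 <= s -> q (s + s) <= 2 * q s.
  move=> s0; have qs0 := q_ge0 s s0.
  rewrite /q (tf_chapman_kolmogorov tf) // mxE sum_states.
  have : 0 <= \sum_i Pt s abs (tr i) * Pt s (tr i) abs.
    by apply: sumr_ge0 => i _; rewrite mulr_ge0 ?(tf_ge0 tf).
  by move: qs0; rewrite /q; nra.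
move=> t0; apply/eqP; rewrite eq_sym -subr_eq0 -/(q t).
move: t0; rewrite le_eqVlt => /orP[/eqP <-|t0].
  by rewrite /q (tf_zero tf) mxE eqxx subrr.
(* After [m] halvings the bound is [t] times a difference quotient at [t * mesh m]; its limit is 0
   because the absorbing row of the intensity matrix is zero. *)
have qm m : q t <= 2 ^+ m * q (t * mesh m).
  elim: m => [|m IH]; first by rewrite /mesh !expr0 mul1r mulr1.
  apply: le_trans IH _; rewrite exprSr -mulrA ler_wpM2l ?exprn_ge0 //.
  have -> : t * mesh m = t * mesh m.+1 + t * mesh m.+1.
    by rewrite [in LHS]mesh_double; lra.
  by apply: q2; rewrite mulr_ge0 ?mesh_ge0 // ltW.
have tm_gt0 m : 0 < t * mesh m by rewrite mulr_gt0 ?mesh_gt0.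
have cvgq : t * - ((Pt (t * mesh m) abs abs - 1) / (t * mesh m))
    @[m --> \oo] --> (0 : R).
  have lim0 : 0 = t * - full_intensity T abs abs.
    by rewrite /full_intensity block_mxEdr mxE oppr0 mulr0.
  have /cvg_at_rightP cvgQ := @tf_intensity _ _ _ _ tf abs abs.
  rewrite [X in _ --> X]lim0; apply: cvgM; first exact: cvg_cst.
  apply: cvgN; rewrite eqxx in cvgQ.
  apply: cvgQ; split=> //.
  rewrite -[X in _ --> X](mulr0 t).
  by apply: cvgM; [exact: cvg_cst|exact: cvg_mesh].
rewrite eq_le; apply/andP; split; last exact/q_ge0/ltW.
apply: (cvgr_to_ge cvgq); apply: nearW => m.
apply: le_trans (qm m) _; rewrite le_eqVlt; apply/orP; left; apply/eqP.
have mesh_neq0 : mesh m != 0 :> R by rewrite gt_eqF ?mesh_gt0.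
have t_neq0 : t != 0 by rewrite gt_eqF.
have -> : 2 ^+ m = (mesh m)^-1 :> R by rewrite /mesh exprVn invrK.
by rewrite /q; field; apply/andP.
Qed.

Lemma tf_absorbing_transient t i : 0 <= t -> Pt t abs (tr i) = 0.
Proof.
move=> t0; have := tf_sum1 tf abs t0.
rewrite sum_states tf_absorbing // => sum1.
have sum0 : \sum_i Pt t abs (tr i) = 0 by lra.
by apply: (psumr_eq0P _ sum0) => // k _; exact: (tf_ge0 tf).
Qed.

Lemma survival_transient t i : 0 <= t ->
  survival (fun t => ulsubmx (Pt t)) t i = 1 - Pt t (tr i) abs.
Proof.
move=> t0; rewrite -(tf_sum1 tf (tr i) t0) sum_states addrK.
by apply: eq_bigr => j _; rewrite !mxE.
Qed.

(** The transient block is multiplicative because paths through the absorbing state never return. *)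
Lemma tf_transient_semigroup :
  substochastic_semigroup T (fun t => ulsubmx (Pt t)).
Proof.
split.
- by move=> t i j t0; rewrite !mxE (tf_ge0 tf).
- move=> t i t0; rewrite -/(survival (fun t => ulsubmx (Pt t)) t i).
  by rewrite survival_transient // gerBl (tf_ge0 tf).
- by rewrite (tf_zero tf) scalar_mx_block block_mxKul.
- move=> s t s0 t0; apply/matrixP => i j.
  rewrite !mxE (tf_chapman_kolmogorov tf) // mxE sum_states.
  rewrite tf_absorbing_transient // mulr0 addr0.
  by apply: eq_bigr => k _; rewrite !mxE.
- move=> i j; have := @tf_intensity _ _ _ _ tf (tr i) (tr j).
  rewrite /full_intensity block_mxEul.
  have -> : (tr i == tr j) = (i == j) by exact: (inj_eq (@lshift_inj p 1)).
  have subE h : (ulsubmx (Pt h) i j - (i == j)%:R) / h =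
      (Pt h (tr i) (tr j) - (i == j)%:R) / h by rewrite !mxE.
  by rewrite (funext subE).
Qed.

End TransitionFunction.

Section AbsorptionTime.
Context {d : measure_display} {Om : measurableType d} {R : realType} {p : nat}.
Context {P : probability Om R} {T : 'M[R]_p} {Pt : R -> 'M[R]_(p + 1)}.
Context {J : R -> Om -> 'I_(p + 1)} {J0 : Om -> 'I_p} {v : 'rV[R]_p}.
Local Notation abs := (@absorbing_state p).
Local Notation tr := (@transient_state p).
Hypothesis tf : transition_function (full_intensity T) Pt.
Hypothesis markov : forall t h i j A, 0 <= t -> 0 <= h -> history J t A ->
  P (A `&` [set w | J t w = i /\ J (t + h) w = j]) =
  (P (A `&` [set w | J t w = i]) * (Pt h i j)%:E)%E.
Hypothesis mJ : forall t s, 0 <= t -> measurable [set w | J t w = s].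
Hypothesis J_right_cont : forall w t, 0 <= t ->
  \forall s \near t^'+, J s w = J t w.
Hypothesis startJ : forall w, J 0 w = tr (J0 w).
Hypothesis lawJ0 : forall j, P [set w | J0 w = j] = (v ord0 j)%:E.

Lemma history_setT t : history J t setT.
Proof.
have [s0 sD _] := smallest_sigma_algebra [set: Om]
  [set A | exists u s, [/\ 0 <= u, u <= t & A = [set w | J u w = s]]].
by rewrite -[setT]setD0; exact: sD.
Qed.

Lemma markov2 t h i j : 0 <= t -> 0 <= h ->
  P [set w | J t w = i /\ J (t + h) w = j] =
  (P [set w | J t w = i] * (Pt h i j)%:E)%E.
Proof.
by move=> t0 h0; have := markov i j t0 h0 (@history_setT t); rewrite !setTI.
Qed.

Lemma start_eventE i : [set w | J0 w = i] = [set w | J 0 w = tr i].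
Proof.
apply/seteqP; split => w /=; rewrite startJ; first by move=> ->.
exact: lshift_inj.
Qed.

Lemma prob_not_absorbed t i : 0 <= t ->
  P ([set w | J t w <> abs] `&` [set w | J0 w = i]) =
  (v ord0 i * survival (fun t => ulsubmx (Pt t)) t i)%:E.
Proof.
move=> t0; rewrite (_ : _ `&` _ = [set w | J0 w = i] `\` [set w | J t w = abs]).
  have m0 : measurable [set w | J0 w = i] by rewrite start_eventE; exact: mJ.
  rewrite measureD //; last 2 first.
  - exact: mJ.
  - exact: le_lt_trans (probability_le1 P m0) (ltry _).
  have -> : [set w | J0 w = i] `&` [set w | J t w = abs] =
      [set w | J 0 w = tr i /\ J (0 + t) w = abs].
    by rewrite start_eventE add0r.
  rewrite [X in (_ - X)%E]markov2 // -start_eventE [X in (X - _)%E]lawJ0 lawJ0.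
  by rewrite (survival_transient tf) // mulrBr mulr1.
by rewrite setDE setIC.
Qed.

(** By the Markov property and [tf_absorbing], being absorbed at both times is as likely as being
    absorbed at [s]. The null set depends on the two times. *)
Lemma ae_absorbed_stays s t : 0 <= s -> s <= t ->
  {ae P, forall w, J s w = abs -> J t w = abs}.
Proof.
move=> s0 st; have t0 := le_trans s0 st.
exists ([set w | J s w = abs] `\` [set w | J t w = abs]); split.
- by apply: measurableD; exact: mJ.
- rewrite measureD; [|exact: mJ|exact: mJ|]; last first.
    by apply: le_lt_trans (probability_le1 P _) (ltry _); exact: mJ.
  have -> : [set w | J s w = abs] `&` [set w | J t w = abs] =
      [set w | J s w = abs /\ J (s + (t - s)) w = abs] by rewrite subrKC.
  rewrite [X in (_ - X)%E]markov2 ?subr_ge0 //.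
  rewrite (tf_absorbing tf) ?subr_ge0 // mule1 subee //.
  by apply: fin_num_measure; exact: mJ.
- by move=> w /= /not_implyP[].
Qed.

Variable X : Om -> R.
Hypothesis hitX : {ae P, forall w, (X w)%:E =
  ereal_inf [set t%:E | t in [set t : R | 0 < t /\ J t w = abs]]}.

(** The hitting time is an infimum over uncountably many times; right-continuity reduces the
    persistence of absorption to rational times, where countably many null sets suffice. *)
Lemma ae_survival_event t : 0 <= t ->
  {ae P, forall w, t < X w <-> J t w <> abs}.
Proof.
move=> t0.
have stays : {ae P, forall w, forall n (q : rat), unpickle n = Some q ->
    0 <= ratr q :> R -> ratr q <= t -> J (ratr q) w = abs -> J t w = abs}.
  apply: ae_foralln => n; case E : (unpickle n) => [q|]; last first.
    by apply: nearW => w q.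
  have [q0|] := boolP (0 <= ratr q :> R); last first.
    by move=> nq0; apply: nearW => w q' [<-] q0; rewrite q0 in nq0.
  have [qt|] := boolP (ratr q <= t); last first.
    by move=> nqt; apply: nearW => w q' [<-] _ qt; rewrite qt in nqt.
  by apply: filterS (ae_absorbed_stays q0 qt) => w Jw q' [<-].
apply: filterS2 hitX stays => w Xw Jw; split.
  move=> tX Jt.
  (* The hitting set contains positive times only; at time 0 the state is transient. *)
  have t_gt0 : 0 < t.
    rewrite lt_neqAle t0 andbT; apply/eqP => t00; move: Jt.
    by rewrite -t00 startJ => /eqP; rewrite eq_lrshift.
  have : ((X w)%:E <= t%:E)%E.
    by rewrite Xw; apply: ereal_inf_lbound; exists t.
  by rewrite lee_fin leNgt tX.
move=> nJt; rewrite ltNge; apply/negP => Xt; apply: nJt.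
have [e /= e0 Je] := J_right_cont w t0.
have [_ [s [s0 Js] <-]] : exists2 y, [set t%:E | t in
    [set t : R | 0 < t /\ J t w = abs]] y & (y < (t + e)%:E)%E.
  by apply: ereal_inf_lt; rewrite -Xw lte_fin; lra.
rewrite lte_fin => ste.
(* An absorbed time [s] just after [t] shares the state of [t]; one before [t] has an absorbed
   rational time between it and [t]. *)
have [ts|st|->//] := ltgtP t s.
  by rewrite -(Je s) //= ltr0_norm ?subr_lt0 //; lra.
have [e' /= e'0 Je'] := J_right_cont w (ltW s0).
have [q] : exists q : rat, ratr q \in `]s, Num.min (s + e') t[.
  by apply: rat_in_itvoo; rewrite lt_min st andbT; lra.
rewrite in_itv /= lt_min => /and3P[sq qe qt].
apply: (Jw (pickle q) q) => //.
- exact: pickleK.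
- exact/ltW/(lt_trans s0).
- exact: ltW.
- by rewrite Je' //= ltr0_norm ?subr_lt0 //; lra.
Qed.

End AbsorptionTime.

(** * Joint survival functions *)

Section NoAtom.
Context {d : measure_display} {Om : measurableType d} {R : realType} {p : nat}.
Context {P : probability Om R} {X : {RV P >-> R}} {J0 : Om -> 'I_p}
  {v : 'I_p -> R} {T : 'M[R]_p} {C : R -> 'M[R]_p}.
Hypothesis semiC : substochastic_semigroup T C.
Hypothesis mJ0 : forall j, measurable [set w | J0 w = j].
Hypothesis v_ge0 : forall j, 0 <= v j.
Hypothesis survX : forall j t, 0 <= t ->
  P ([set w | t < X w] `&` [set w | J0 w = j]) = (v j * survival C t j)%:E.
Hypothesis posX : {ae P, forall w, 0 < X w}.

Lemma measurable_RV_eq x : measurable [set w | X w = x].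
Proof.
rewrite (_ : [set w | _] = setT `&` X @^-1` [set x]).
  exact: measurable_funP.
by rewrite setTI.
Qed.

(** The bound does not depend on [s], since [C s j b] is at most 1: survival is uniformly
    continuous. *)
Lemma survival_increment_le s t j : 0 <= s -> 0 <= t ->
  survival C s j - survival C (s + t) j <= \sum_b (1 - survival C t b).
Proof.
move=> s0 t0; rewrite (survivalD semiC) // -sumrB; apply: ler_sum => b _.
rewrite -[X in X - _]mulr1 -mulrBr -[leRHS]mul1r ler_wpM2r //.
  by rewrite subr_ge0 (survival_le1 semiC).
exact: le_trans (ssg_le_survival semiC _ _ s0) (survival_le1 semiC _ s0).
Qed.

(** For positive [x], the atom lies in a short interval ending at [x]. Its left end moves with [m],
    so a bound on the increment uniform in the starting time is required. *)
Lemma no_atom x : P [set w | X w = x] = 0%E.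
Proof.
have mX := measurable_RV_eq x.
have [x0|x0] := leP x 0.
  apply: measure_negligible => //; apply: negligibleS posX => w /= ->.
  by rewrite ltNge x0.
have cvg0 : \sum_j v j * \sum_b (1 - survival C (mesh m) b)
    @[m --> \oo] --> (0 : R).
  have lim0 : 0 = \sum_(j < p) v j * \sum_(b < p) (1 - 1).
    by rewrite big1 // => j _; rewrite big1 ?mulr0 // => b _; rewrite subrr.
  rewrite [X in _ --> X]lim0; apply: cvg_fin_sum => j.
  apply: cvgM; first exact: cvg_cst.
  apply: cvg_fin_sum => b.
  by apply: cvgB; [exact: cvg_cst|exact: (cvg_survival_mesh semiC)].
have PfinX := fin_num_measure P _ mX.
rewrite -(fineK PfinX); congr (_%:E).
apply/eqP; rewrite eq_le fine_ge0 ?measure_ge0 // andbT.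
apply: (cvgr_to_ge cvg0).
have small : \forall m \near \oo, mesh m < x by exact: (cvgr_lt _ cvg_mesh).
apply: filterS small => m mx; have m0 := @mesh_ge0 R m.
have xm0 : 0 <= x - mesh m by rewrite subr_ge0 ltW.
have mi := measurable_RV_itv X (x - mesh m) x.
rewrite -lee_fin (fineK PfinX).
apply: (@le_trans _ _ (P [set w | x - mesh m < X w <= x])).
  apply: le_measure; rewrite ?inE // => w /= ->.
  by rewrite lexx andbT ltrBlDr ltrDl mesh_gt0.
have -> : [set w | x - mesh m < X w <= x] =
    \bigcup_j ([set w | x - mesh m < X w <= x] `&` [set w | J0 w = j]).
  by apply/seteqP; split => [w Xw|w [j _ []//]]; exists (J0 w).
rewrite measure_finType_bigcup.
- rewrite -sumEFin; apply: lee_sum => j _.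
  rewrite (_ : _ (_ `&` _) = (v j * (survival C (x - mesh m) j -
      survival C x j))%:E); last first.
    transitivity (P ([set w | x - mesh m < X w <= x] `&` [set w | J0 w = j])).
      by [].
    by rewrite prob_RV_itv ?gerBl // !survX // ?mulrBr // ltW.
  rewrite lee_fin ler_wpM2l //.
  by have := survival_increment_le j xm0 m0; rewrite subrK.
- by move=> j; exact: measurableI.
- by move=> i j w [_ <-] [_ <-].
Qed.

End NoAtom.

(** * Joint probabilities from conditional independence *)

Section ConditionalIndependence.
Context {d : measure_display} {Om : measurableType d} {R : realType}
  {n p q : nat}.
Context {P : probability Om R} {J : 'I_n -> R -> Om -> 'I_q}
  {J0 : Om -> 'I_p}.
Hypothesis indep : cond_independent P J J0.

Lemma process_eventsT (I : R -> Om -> 'I_q) : process_events I setT.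
Proof.
have [s0 sD _] := smallest_sigma_algebra [set: Om]
  [set A | exists u s, 0 <= u /\ A = [set w | I u w = s]].
by rewrite -[setT]setD0; exact: sD.
Qed.

Lemma process_events_neq (I : R -> Om -> 'I_q) t s : 0 <= t ->
  process_events I [set w | I t w <> s].
Proof.
move=> t0.
have [_ sD _] := smallest_sigma_algebra [set: Om]
  [set A | exists u s, 0 <= u /\ A = [set w | I u w = s]].
rewrite (_ : [set w | _] = setT `\` [set w | I t w = s]).
  by apply: sD; apply: sub_sigma_algebra; exists t, s.
by apply/seteqP; split => w //= -[].
Qed.

Lemma cond_indep_joint k l j (A B : set Om) (vj a b : R) : k != l ->
  process_events (J k) A -> process_events (J l) B ->
  measurable A -> measurable B -> measurable [set w | J0 w = j] ->
  P [set w | J0 w = j] = vj%:E ->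
  P (A `&` [set w | J0 w = j]) = (vj * a)%:E ->
  P (B `&` [set w | J0 w = j]) = (vj * b)%:E ->
  P (A `&` (B `&` [set w | J0 w = j])) = (vj * (a * b))%:E.
Proof.
move=> kl evA evB mA mB mj Pj PA PB.
have mAB : measurable (A `&` (B `&` [set w | J0 w = j])).
  by do 2!apply: measurableI => //.
have vj0 : 0 <= vj by rewrite -lee_fin -Pj measure_ge0.
(* Initial states of probability zero are treated apart: [cond_independent] says nothing about
   them. *)
move: vj0; rewrite le_eqVlt => /orP[/eqP v0|v_gt0].
  rewrite -v0 mul0r; apply: (subset_measure0 mAB mj).
    by move=> w [_ []].
  by rewrite -v0 in Pj.
(* Padding the other coordinates with the sure event makes their factors 1. *)
pose AB i := if i == k then A else if i == l then B else setT.
have := indep (A := AB) (j := j).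
rewrite Pj lte_fin => /(_ v_gt0).
have evAB i : process_events (J i) (AB i).
  rewrite /AB; case: eqVneq => [-> //|_].
  by case: eqVneq => [-> //|_]; exact: process_eventsT.
move=> /(_ evAB).
rewrite (bigD1 k) //= (bigD1 l) /=; last by rewrite eq_sym.
rewrite big1 => [|i /andP[ik il]]; last first.
  rewrite /AB (negPf ik) (negPf il) /cond_prob setTI Pj /=.
  by rewrite divff // gt_eqF.
have -> : AB k = A by rewrite /AB eqxx.
have -> : AB l = B by rewrite /AB eq_sym (negPf kl) eqxx.
have -> : \bigcap_i AB i = A `&` B.
  apply/seteqP; split => [w ABw|w [Aw Bw] i _].
    split; first by have := ABw k I; rewrite /AB eqxx.
    by have := ABw l I; rewrite /AB eq_sym (negPf kl) eqxx.
  by rewrite /AB; case: eqP => // _; case: eqP.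
rewrite /cond_prob PA PB Pj /= -setIA => E.
rewrite -[LHS]fineK; last exact: fin_num_measure.
have vn0 : vj != 0 by rewrite gt_eqF.
congr (_%:E); move/(canRL (mulfVK vn0)): E => ->.
by field.
Qed.

End ConditionalIndependence.

(** Collects what is needed of one coordinate, hiding the transition function behind the semigroup
    [C]. *)
Lemma mPH_component {disp : measure_display} {Om : measurableType disp}
    {R : realType} {P : probability Om R} {p : nat} {v : 'rV[R]_p}
    {T : 'M[R]_p} {J : R -> Om -> 'I_(p + 1)} {J0 : Om -> 'I_p}
    {X : {RV P >-> R}} :
  (forall w, J 0 w = transient_state (J0 w)) ->
  (forall j, P [set w | J0 w = j] = (v ord0 j)%:E) ->
  markov_jump_process P (full_intensity T) J ->
  {ae P, forall w, (X w)%:E = ereal_inf [set t%:E | t in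
    [set t : R | 0 < t /\ J t w = absorbing_state]]} ->
  exists C, [/\ substochastic_semigroup T C,
    forall t j, 0 <= t ->
      P ([set w | J t w <> absorbing_state] `&` [set w | J0 w = j]) =
      (v ord0 j * survival C t j)%:E,
    forall t, 0 <= t -> {ae P, forall w, t < X w <-> J t w <> absorbing_state}
    & forall t, 0 <= t -> measurable [set w | J t w <> absorbing_state]].
Proof.
move=> startJ lawJ0 [mJ rc _ [Pt tf markov]] hit.
exists (fun t => ulsubmx (Pt t)); split.
- exact: tf_transient_semigroup.
- by move=> t j t0; exact: (prob_not_absorbed tf markov mJ startJ lawJ0).
- by move=> t t0; exact: (ae_survival_event tf markov mJ rc startJ hit).
- move=> t t0; rewrite (_ : [set w | _] = ~` [set w | J t w = absorbing_state]) //.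
  by apply: measurableC; exact: mJ.
Qed.

Theorem theorem2p8 (disp : measure_display) (Om : measurableType disp)
    (R : realType) (P : probability Om R) (d p : nat)
    (v : 'rV[R]_p) (T : 'I_d -> 'M[R]_p) (X : 'I_d -> {RV P >-> R})
    (hX : mPH v T X) (k l : 'I_d) (hkl : k != l) :
  kendall_tau (X k) (X l) =
  4 * (\sum_(i < p) \sum_(j < p) v ord0 i * v ord0 j *
        (((basis_vec i)^T *t (basis_vec j)^T) *m
           invmx (- kron_sum (T k) (T k)) *m
           (ones *t exit_rates (T k))) ord0 ord0 *
        (((basis_vec i)^T *t (basis_vec j)^T) *m
           invmx (- kron_sum (T l) (T l)) *m
           (ones *t exit_rates (T l))) ord0 ord0)
  - 1.
Proof.
case: hX => -[v_ge0 v_sum1] hT [J [J0 [hJ0 startJ mjpJ indep hit]]].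
have mJ0 j : measurable [set w | J0 w = j] by case: (hJ0 j).
have lawJ0 j : P [set w | J0 w = j] = (v ord0 j)%:E by case: (hJ0 j).
have [Ck [semiCk probk survk mk]] :=
  mPH_component (startJ k) lawJ0 (mjpJ k) (hit k).
have [Cl [semiCl probl survl ml]] :=
  mPH_component (startJ l) lawJ0 (mjpJ l) (hit l).
have pos i : (forall t, 0 <= t -> {ae P, forall w, t < X i w <->
      J i t w <> absorbing_state}) -> {ae P, forall w, 0 < X i w}.
  move=> surv; apply: filterS (surv 0 (lexx 0)) => w [_]; apply.
  by rewrite startJ => /eqP; rewrite eq_lrshift.
(* Transfers survival probabilities from the states of the process to its absorption time. *)
have marg i C :
    (forall t j, 0 <= t ->
      P ([set w | J i t w <> absorbing_state] `&` [set w | J0 w = j]) =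
      (v ord0 j * survival C t j)%:E) ->
    (forall t, 0 <= t -> {ae P, forall w, t < X i w <->
      J i t w <> absorbing_state}) ->
    (forall t, 0 <= t -> measurable [set w | J i t w <> absorbing_state]) ->
    forall j t, 0 <= t -> P ([set w | t < X i w] `&` [set w | J0 w = j]) =
      (v ord0 j * survival C t j)%:E.
  move=> prob surv mi j t t0; rewrite -prob //; apply: ae_measure_eq.
  - by apply: measurableI => //; exact: measurable_RV_gt.
  - by apply: measurableI => //; exact: mi.
  - by apply: filterS (surv t t0) => w /= ->.
have joint j s t : 0 <= s -> 0 <= t ->
    P ([set w | s < X k w] `&` ([set w | t < X l w] `&` [set w | J0 w = j])) =
    (v ord0 j * (survival Ck s j * survival Cl t j))%:E.
  move=> s0 t0.
  have evk : process_events (J k) [set w | J k s w <> absorbing_state].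
    exact: process_events_neq.
  have evl : process_events (J l) [set w | J l t w <> absorbing_state].
    exact: process_events_neq.
  rewrite -(cond_indep_joint indep hkl evk evl (mk s s0) (ml t t0) (mJ0 j)
    (lawJ0 j) (probk s j s0) (probl t j t0)).
  apply: ae_measure_eq.
  - by do 2![apply: measurableI => //; first exact: measurable_RV_gt].
  - by apply: measurableI; [exact: mk|apply: measurableI => //; exact: ml].
  - by apply: filterS2 (survk s s0) (survl t t0) => w /= -> ->.
have [subk unitk] := hT k; have [subl unitl] := hT l.
(* The two matrix factors of the goal are unfolded instances of [overtake]. *)
apply: (kendall_tau_survival mJ0 joint).
- exact: (cvg_overtake subk unitk semiCk).
- exact: (cvg_overtake subl unitl semiCl).
- exact: pos survk.
- exact: pos survl.
- exact: (no_atom semiCk mJ0 v_ge0 (marg k Ck probk survk mk)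
    (pos k survk)).
- exact: (no_atom semiCl mJ0 v_ge0 (marg l Cl probl survl ml)
    (pos l survl)).
Qed.
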